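(* Let $m\ge 1$ and consider the hypercube code $QRM_m(0,1)$. For each $K\subseteq S$, $$Z(|K|-1)_{\langle K\rangle}\equiv\overline{C^{\mathscr{P}(K)}Z},$$ where $\mathscr{P}(K)$ is the power set of $K$ and each $i\in K$ is identified with the logical qubit indexed by $\{i\}$; that is, the right-hand side is the product over all subsets $J\subseteq K$ of the multi-controlled-$Z$ gate on the logical qubits $\{\{i\}:i\in J\}$.
   Context: $S=\{e_1,\dots,e_m\}$ is the standard basis of $\mathbb{Z}_2^m$ (identified with $[m]$). For $J\subseteq S$, $\langle J\rangle$ is the subgroup generated by $J$. A subcube of type $J$ is a coset $x+\langle J\rangle$, of dimension $|J|$. $2^m$ physical qubits are indexed by $\mathbb{Z}_2^m$; $U_A$ acts as the single-qubit gate $U$ on qubits in $A$ and identity elsewhere. $QRM_m(0,1)$ is the common $+1$ eigenspace of $X_{\mathbb{Z}_2^m}$ and of all $Z_A$ with $A$ a $2$-dimensional subcube. $Z(k)=\mathrm{diag}(1,e^{i\pi/2^k})$ (so $Z(-1)$ is the identity), and $Z(k)_A$ acts as $Z(k)$ on qubits in $A$ and identity elsewhere. Logical qubits are indexed by the singletons $\{i\}$, $i\in S$, with logical Paulis $\overline{Z}_{\{i\}}=Z_{\langle e_i\rangle}$, $\overline{X}_{\{i\}}=X_{e_i+\langle S\setminus\{e_i\}\rangle}$. Logical computational basis: $|\overline0\rangle$ is the unit code state (unique up to phase) fixed by all $\overline{Z}_{\{i\}}$, and $|\overline a\rangle=\prod_i\overline{X}_{\{i\}}^{a_i}|\overline0\rangle$,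 $a\in\{0,1\}^m$. For nonempty $J\subseteq S$ the multi-controlled-$Z$ gate $\overline{C^JZ}$ maps $|\overline a\rangle$ to $-|\overline a\rangle$ if $a_i=1$ for all $i\in J$ and fixes $|\overline a\rangle$ otherwise; $\overline{C^\emptyset Z}$ is the identity. $U\equiv V$ means that for some real $\theta$, $U|\psi\rangle=e^{i\theta}V|\psi\rangle$ for every code state $|\psi\rangle$. *)

(* Defs.v *)
From mathcomp Require Import all_boot all_order all_fingroup all_algebra.
From mathcomp Require Import reals trigo.
From mathcomp Require Export complex.

Set Implicit Arguments.
Unset Strict Implicit.
Unset Printing Implicit Defensive.

Import Order.TTheory GRing.Theory Num.Theory.
Local Open Scope ring_scope.
Local Open Scope complex_scope.

(* The generated subgroup is taken for the additive group structure of
   'rV['F_2]_m, which is the library's group structure on this type. *)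
Definition cube (m : nat) : finZmodType := 'rV['F_2]_m.

Definition e_ (m : nat) (i : 'I_m) : cube m := delta_mx 0 i.

Definition gen (m : nat) (J : {set 'I_m}) : {set cube m} :=
  <<[set e_ i | i in J]>>%g.

Definition subcube (m : nat) (x : cube m) (J : {set 'I_m}) : {set cube m} :=
  [set x + y | y in gen J].

(* Vectors of the Hilbert space of the qubits indexed by [cube m], by their amplitudes on the
   computational basis: [s q] is the bit of the basis vector |s> at qubit q. *)
Definition bits (m : nat) : finType := {ffun cube m -> 'I_2}.
Definition state (R : realType) (m : nat) := {ffun bits m -> R[i]}.

(* Matrix entry (s, t) of the tensor product, over all qubits q, of U if
   q \in A and of the identity otherwise. *)
Definition gate_entry (R : realType) (m : nat) (U : 'M[R[i]]_2)
    (A : {set cube m}) (s t : bits m) : R[i] :=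
  \prod_(q : cube m) (if q \in A then U else 1%:M) (s q) (t q).

Definition gate (R : realType) (m : nat) (U : 'M[R[i]]_2)
    (A : {set cube m}) (psi : state R m) : state R m :=
  [ffun s => \sum_(t : bits m) gate_entry U A s t * psi t].

Definition cis (R : realType) (t : R) : R[i] := cos t +i* sin t.

Definition pauliX (R : realType) : 'M[R[i]]_2 :=
  \matrix_(i, j) (i != j)%:R.

Definition pauliZ (R : realType) : 'M[R[i]]_2 :=
  diag_mx (\row_j (if j == 0 then 1 else -1)).

Definition Zk (R : realType) (k : int) : 'M[R[i]]_2 :=
  diag_mx (\row_j (if j == 0 then 1 else cis (pi / (2 : R) ^ k))).

Definition in_code (R : realType) (m : nat) (psi : state R m) : Prop :=
  gate (pauliX R) [set: cube m] psi = psi /\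
  forall (x : cube m) (J : {set 'I_m}), #|J| = 2%N ->
    gate (pauliZ R) (subcube x J) psi = psi.

Definition logicalZ (R : realType) (m : nat) (i : 'I_m) :
    state R m -> state R m :=
  gate (pauliZ R) (gen [set i]).

Definition logicalX (R : realType) (m : nat) (i : 'I_m) :
    state R m -> state R m :=
  gate (pauliX R) (subcube (e_ i) [set~ i]).

Definition unit_state (R : realType) (m : nat) (psi : state R m) : Prop :=
  \sum_(s : bits m) `|psi s| ^+ 2 = 1.

(* Determines psi up to a phase. *)
Definition logical_zero (R : realType) (m : nat) (psi : state R m) : Prop :=
  [/\ in_code psi, unit_state psi & forall i : 'I_m, logicalZ i psi = psi].

Definition comp_all (R : realType) (m : nat) (I : Type) (r : seq I)
    (F : I -> state R m -> state R m) (psi : state R m) : state R m :=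
  foldr F psi r.

Definition logical_basis (R : realType) (m : nat) (psi0 : state R m)
    (a : {ffun 'I_m -> bool}) : state R m :=
  comp_all (enum 'I_m) (fun i => iter (a i) (logicalX i)) psi0.

(* A logical gate is prescribed only on the code, so it is a property of a
   linear operator W, which may act arbitrarily off the code. *)
Definition is_multi_CZ (R : realType) (m : nat) (psi0 : state R m)
    (J : {set 'I_m}) (W : {linear state R m -> state R m}) : Prop :=
  if J == set0 then forall psi : state R m, in_code psi -> W psi = psi
  else forall a : {ffun 'I_m -> bool},
    W (logical_basis psi0 a) =
      (if [forall i in J, a i] then - logical_basis psi0 a
       else logical_basis psi0 a).

Definition code_equiv (R : realType) (m : nat)
    (U V : state R m -> state R m) : Prop :=
  exists theta : R, forall psi : state R m,
    in_code psi -> U psi = cis theta *: V psi.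

(* Main.v *)
(* A code state is supported on the bit strings [s] whose parity vanishes on
   every two-dimensional face, i.e. on the affine functions
   s(q) = c + sum_(i | a i) q_i, and its amplitudes do not depend on [c].  The
   logical basis state |a> is supported on the two strings with linear part [a].
   On the subgroup generated by K such a string is constant when [a] vanishes on
   K, and takes the value 1 at exactly 2 ^ (|K| - 1) points otherwise.  Hence
   Z(|K| - 1) multiplies |a> by 1, resp. by -1, while the product of the
   controlled gates multiplies it by (-1) ^ (2 ^ |A| - 1) where A is the set of
   the i in K with a_i = 1, which is the same sign. *)
Require Import Defs.
From mathcomp Require Import all_boot all_order all_fingroup all_algebra.
From mathcomp Require Import reals trigo.

Set Implicit Arguments.
Unset Strict Implicit.
Unset Printing Implicit Defensive.

Import GRing.Theory Num.Theory.
Local Open Scope ring_scope.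
Local Open Scope complex_scope.

(** * Coordinate subgroups of the cube *)

Lemma gen_ind (m : nat) (J : {set 'I_m}) (P : cube m -> Prop) :
  P 0 -> (forall x i, i \in J -> P x -> P (x + e_ i)) ->
  forall x, x \in gen J -> P x.
Proof.
(* In a finite group a generated element is a product of generators without inverses; the induction
   is on its length. *)
move=> P0 PS x /gen_prodgP[n [c cJ ->]].
elim: n c cJ => [|n IHn] c cJ; first by rewrite big_ord0.
rewrite big_ord_recr /=; have /imsetP[i iJ ->] := cJ ord_max.
by apply: PS => //; apply: IHn => k; apply: cJ.
Qed.

Lemma cube_sum (m : nat) (x : cube m) :
  x = \sum_i (if x 0 i == 1 then e_ i else 0).
Proof.
rewrite {1}[x]row_sum_delta; apply: eq_bigr => i _.
case: eqP => [->|/eqP x1]; first by rewrite scale1r.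
suff -> : x 0 i = 0 by rewrite scale0r.
by apply/val_inj; move: x1; case: (x 0 i) => -[|[|k]].
Qed.

Lemma in_gen (m : nat) (J : {set 'I_m}) (x : cube m) :
  (x \in gen J) = [forall i, (x 0 i == 1) ==> (i \in J)].
Proof.
apply/idP/forallP => [|xJ].
  apply: (gen_ind (P := fun x => forall i, _)) => [i|y j jJ yJ i].
    by rewrite mxE.
  rewrite !mxE eqxx /=; case: (eqVneq i j) => [->|_]; first by rewrite jJ implybT.
  by rewrite addr0; apply: yJ.
rewrite [x]cube_sum; apply: (big_ind (fun y => y \in gen J)) => [|y z|i _].
- exact: group1.
- exact: groupM.
case: ifP => xi; last exact: group1.
by apply/mem_gen/imset_f/(implyP (xJ i)).
Qed.

(** The permutation of the computational basis induced by Pauli X on [A]. *)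
Definition flip (m : nat) (A : {set cube m}) (s : bits m) : bits m :=
  [ffun q => (s q : 'F_2) + (q \in A)%:R].

Lemma neq_addF2_1 (x y : 'I_2) : (x != y) = (y == (x : 'F_2) + 1 :> 'I_2).
Proof. by case: x => -[|[|?]] //= ?; case: y => -[|[|?]]. Qed.

Definition affine (m : nat) (c : 'F_2) (a : {ffun 'I_m -> bool}) : bits m :=
  [ffun q : cube m => c + \sum_(i | a i) q 0 i].

(** * Action of diagonal and Pauli gates on amplitudes *)

Section Gates.
Variables (R : realType) (m : nat).
Implicit Types (psi : state R m) (A : {set cube m}).

Lemma gate_diag (d : 'rV[R[i]]_2) A psi s :
  gate (diag_mx d) A psi s = (\prod_(q in A) d 0 (s q)) * psi s.
Proof.
rewrite ffunE (bigD1 s) //= [X in _ + X]big1 ?addr0 => [|t ts].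
  congr (_ * _); rewrite /gate_entry [RHS]big_mkcond; apply: eq_bigr => q _.
  by case: ifP => _; rewrite !mxE eqxx.
(* Distinct strings differ at some qubit, whose diagonal local factor kills the whole matrix
   entry. *)
have [q sq] : exists q, t q != s q.
  by apply/existsP; apply: contraNT ts => /existsPn ts; apply/eqP/ffunP => q;
     apply/eqP; rewrite -[_ == _]negbK.
rewrite /gate_entry (bigD1 q) //=.
by case: ifP => _; rewrite !mxE eq_sym (negPf sq) ?mulr0n !mul0r.
Qed.

Lemma gate_pauliX A psi s : gate (pauliX R) A psi s = psi (flip A s).
Proof.
have entry q (x y : 'I_2) : (if q \in A then pauliX R else 1%:M) x y =
    (y == (x : 'F_2) + (q \in A)%:R :> 'I_2)%:R.
  by case: ifP => _; rewrite !mxE ?neq_addF2_1 // addr0 eq_sym.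
rewrite ffunE (bigD1 (flip A s)) //= [X in _ + X]big1 ?addr0 => [|t ts].
  by rewrite /gate_entry big1 ?mul1r // => q _; rewrite entry ffunE eqxx.
have [q sq] : exists q, t q != flip A s q.
  by apply/existsP; apply: contraNT ts => /existsPn ts; apply/eqP/ffunP => q;
     apply/eqP; rewrite -[_ == _]negbK.
rewrite /gate_entry (bigD1 q) //= entry.
by move: sq; rewrite ffunE => /negPf ->; rewrite !mul0r.
Qed.

(** The nontrivial character of F_2; it turns products of Pauli Z eigenvalues into parities. *)
Definition bit_sign (x : 'I_2) : R[i] := if x == 0 then 1 else -1.

Lemma bit_signD (x y : 'F_2) : bit_sign (x + y) = bit_sign x * bit_sign y.
Proof.
by case: x => -[|[|?]] //= ?; case: y => -[|[|?]] //= ?;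
   rewrite /bit_sign /= ?mulr1 ?mul1r // mulrNN mulr1.
Qed.

Lemma bit_sign_eq1 (x : 'I_2) : bit_sign x = 1 -> x = 0.
Proof.
rewrite /bit_sign; case: eqP => // _ /eqP.
by rewrite eq_sym -addr_eq0 -mulr2n pnatr_eq0.
Qed.

Lemma gate_pauliZ A psi s :
  gate (pauliZ R) A psi s = (\prod_(q in A) bit_sign (s q)) * psi s.
Proof. by rewrite gate_diag; congr (_ * _); apply: eq_bigr => q _; rewrite mxE. Qed.

End Gates.

(** * Products over subcubes, and affine strings *)

Section Cubes.
Variables (m : nat).
Implicit Types (J : {set 'I_m}) (x : cube m).

Lemma addrr_F2 (x : 'F_2) : x + x = 0.
Proof. by rewrite -mulr2n -mulr_natr pchar_Fp_0 ?mulr0. Qed.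

Lemma oppr_F2 (x : 'F_2) : - x = x.
Proof. by apply/eqP; rewrite eq_sym -addr_eq0 addrr_F2. Qed.

Lemma addF2_neq (x y : 'F_2) : x + y = (x != y)%:R.
Proof. by case: x => -[|[|?]] //= ?; case: y => -[|[|?]] //= ?; apply/val_inj. Qed.

Lemma addrr_cube x : x + x = 0.
Proof. by apply/rowP => i; rewrite !mxE addrr_F2. Qed.

Lemma gen_set0 : gen (set0 : {set 'I_m}) = [set 0].
Proof. by rewrite /gen imset0 gen0. Qed.

(** Coordinate [i] splits the larger subgroup into [gen J] and its translate by [e_ i]. This
    recursion yields cardinalities, face parities and the pairing of qubits along [e_ i]. *)
Lemma big_gen_setU1 (T : Type) (idx : T) (op : Monoid.com_law idx)
    (F : cube m -> T) i J : i \notin J ->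
  \big[op/idx]_(y in gen (i |: J)) F y =
    \big[op/idx]_(y in gen J) op (F y) (F (y + e_ i)).
Proof.
move=> iJ; rewrite (bigID (fun y : cube m => y 0 i == 1)) Monoid.mulmC big_split.
congr (op _ _).
  apply: eq_bigl => y; rewrite !in_gen; apply/andP/forallP => [[/forallP yJ yi] j|yJ].
    apply/implyP => yj; have := yJ j; rewrite yj in_setU1.
    by case: eqP => // ji; rewrite -ji yj in yi.
  split; last by apply: contra iJ => /(implyP (yJ i)).
  apply/forallP => j; rewrite in_setU1.
  by apply/implyP => /(implyP (yJ j)) ->; rewrite orbT.
rewrite (reindex_inj (addIr (e_ i))); apply: eq_bigl => y.
rewrite !in_gen; apply/andP/forallP => [[/forallP yJ yi] j|yJ].
  have := yJ j; move: yi; rewrite !mxE !eqxx in_setU1; case: (eqVneq j i) => [->|ji] /=.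
    by case: (y 0 i) => -[|[|?]].
  by rewrite addr0.
have yi : y 0 i != 1 by apply: contra iJ => /(implyP (yJ i)).
split; last by rewrite !mxE !eqxx; move: yi; case: (y 0 i) => -[|[|?]].
apply/forallP => j; rewrite in_setU1 !mxE eqxx /=.
by case: (eqVneq j i) => [->|ji]; rewrite ?implybT ?addr0.
Qed.

Lemma card_gen J : #|gen J| = (2 ^ #|J|)%N.
Proof.
elim: {J}_.+1 {-2}J (ltnSn #|J|) => // n IHn J.
have [->|[i iJ]] := set_0Vmem J; first by rewrite gen_set0 cards0 cards1.
rewrite -(setD1K iJ) cardsU1 setD11 add1n ltnS => Jn.
by rewrite -sum1_card big_gen_setU1 ?setD11 //= sum_nat_const IHn ?expnSr.
Qed.

Lemma mem_facet x i : (x \in subcube (e_ i) [set~ i]) = (x 0 i == 1).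
Proof.
have -> : (x \in subcube (e_ i) [set~ i]) = (x - e_ i \in gen [set~ i]).
  apply/imsetP/idP => [[y yG ->]|xG]; first by rewrite addrC addKr.
  by exists (x - e_ i) => //; rewrite addrC subrK.
rewrite in_gen; apply/forallP/eqP => [/(_ i)|xi j].
  by rewrite !mxE !eqxx !inE eqxx; case: (x 0 i) => -[|[|?]] //= ? _; apply/val_inj.
by rewrite !mxE !inE eqxx; case: (eqVneq j i) => [->|ji]; rewrite ?implybT ?xi ?subrr.
Qed.

Lemma big_subcube2 (T : Type) (idx : T) (op : Monoid.com_law idx)
    (F : cube m -> T) x i j : i != j ->
  \big[op/idx]_(y in subcube x [set i; j]) F y =
    op (op (F x) (F (x + e_ j))) (op (F (x + e_ i)) (F (x + e_ j + e_ i))).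
Proof.
move=> ij; rewrite big_imset => [|y z _ _ /addrI//].
rewrite big_gen_setU1 ?inE // -[[set j]]setU0 big_gen_setU1 ?inE // gen_set0 big_set1.
by rewrite addr0 !add0r addrA Monoid.mulmACA.
Qed.

Lemma affine0 c (a : {ffun 'I_m -> bool}) : affine c a 0 = c.
Proof. by rewrite ffunE big1 ?addr0 // => i _; rewrite mxE. Qed.

Lemma affine_shift c (a : {ffun 'I_m -> bool}) x i :
  affine c a (x + e_ i) = (affine c a x : 'F_2) + (a i)%:R :> 'I_2.
Proof.
rewrite !ffunE -addrA; congr (_ + _).
under eq_bigr do rewrite mxE; rewrite big_split /=; congr (_ + _).
under eq_bigr do rewrite mxE eqxx eq_sym /=.
case ai: (a i).
  rewrite (bigD1 i) //= eqxx big1 ?addr0 // => j /andP[_ /negPf ji].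
  by rewrite eq_sym ji.
by apply: big1 => j aj; case: eqP => // ij; rewrite ij aj in ai.
Qed.

Lemma affine_inj c c' (a a' : {ffun 'I_m -> bool}) :
  affine c a = affine c' a' -> a = a'.
Proof.
move=> eq_aff; apply/ffunP => i; have := affine_shift c a 0 i.
rewrite eq_aff affine_shift !affine0 => /addrI.
by case: (a i); case: (a' i).
Qed.

End Cubes.

(** * Support and symmetry of code states *)

Section Code.
Variables (R : realType) (m : nat).
Implicit Types (psi : state R m) (a : {ffun 'I_m -> bool}).

Lemma code_flip psi s : in_code psi -> psi (flip setT s) = psi s.
Proof. by case=> Xpsi _; rewrite -[in RHS]Xpsi gate_pauliX. Qed.

(** The face stabilizer multiplies the amplitude at [s] by the sign of the parity of [s] on the
    face; a nonzero amplitude can only be fixed if that sign is 1. *)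
Lemma code_face psi s x i j : in_code psi -> psi s != 0 -> i != j ->
  (s x : 'F_2) + s (x + e_ j) + (s (x + e_ i) + s (x + e_ j + e_ i)) = 0.
Proof.
move=> [_ Zpsi] s0 ij.
have Zx : gate (pauliZ R) (subcube x [set i; j]) psi = psi.
  by apply: Zpsi; rewrite cards2 ij.
have := gate_pauliZ (subcube x [set i; j]) psi s.
rewrite Zx -[LHS]mul1r => /(mulIf s0) /esym.
rewrite big_subcube2 //= -!bit_signD; exact: bit_sign_eq1.
Qed.

(** Even face parity makes the increment of [s] along [e_ i] independent of the base point, so [s]
    is determined by its value and increments at 0. *)
Lemma code_affine psi s : in_code psi -> psi s != 0 ->
  s = affine (s 0) [ffun i => s (e_ i) != s 0].
Proof.
move=> psiC s0.
have genT x : x \in gen [set: 'I_m].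
  by rewrite in_gen; apply/forallP => i; rewrite inE implybT.
have slope i x : (s (x + e_ i) : 'F_2) = (s x : 'F_2) + (s (e_ i) != s 0)%:R.
  have : (s (x + e_ i) : 'F_2) + s x = (s (e_ i) : 'F_2) + s 0.
    apply: (gen_ind (P := fun x => (s (x + e_ i) : 'F_2) + s x = _) _ _ (genT x)).
      by rewrite add0r.
    (* For [j = i] the ends of the edge are swapped; otherwise the face parity transports the
       increment. *)
    move=> y j _ <-; case: (eqVneq i j) => [<-|ij].
      by rewrite -addrA addrr_cube addr0 addrC.
    have /eqP := code_face y psiC s0 ij.
    rewrite addrACA addr_eq0 oppr_F2 => /eqP.
    by rewrite addrC => ->; apply: addrC.
  by rewrite -addF2_neq => <-; rewrite addrCA addrr_F2 addr0.
apply/ffunP => x.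
apply: (gen_ind (P := fun x => s x = _ x) _ _ (genT x)) => [|y i _ sy].
  by rewrite affine0.
by rewrite slope affine_shift sy; congr (_ + _); rewrite ffunE.
Qed.

Lemma flip_affine c a : flip setT (affine c a) = affine (c + 1) a.
Proof. by apply/ffunP => q; rewrite !ffunE inE addrAC. Qed.

(** Adding 1 to the constant is the global flip, which is the X stabilizer. *)
Lemma code_affine_const psi c a : in_code psi -> psi (affine c a) = psi (affine 0 a).
Proof.
move=> psiC; have [->//|c1] := eqVneq c 0.
have -> : c = 0 + 1 by rewrite -[LHS]addr0 addF2_neq c1 add0r.
by rewrite -flip_affine code_flip.
Qed.

End Code.

(** * The logical basis and its span *)

Section Basis.
Variables (R : realType) (m : nat) (psi0 : state R m).
Hypothesis psi0P : logical_zero psi0.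
Implicit Types (psi : state R m) (a : {ffun 'I_m -> bool}) (J K : {set 'I_m}).

(** The facet carrying [logicalX i] is where coordinate [i] is 1, so each such gate adds the form
    q_i to the string. *)
Lemma logical_basisE a s : logical_basis psi0 a s =
  psi0 [ffun q : cube m => (s q : 'F_2) + affine 0 a q].
Proof.
have step r : comp_all r (fun i => iter (a i) (logicalX i)) psi0 s =
    psi0 [ffun q : cube m => (s q : 'F_2) + \sum_(i <- r | a i) q 0 i].
  elim: r s => [|i r IHr] s /=.
    by congr (psi0 _); apply/ffunP => q; rewrite ffunE big_nil addr0.
  case ai: (a i) => /=; last first.
    by rewrite IHr; congr (psi0 _); apply/ffunP => q; rewrite !ffunE big_cons ai.
  rewrite gate_pauliX IHr; congr (psi0 _); apply/ffunP => q.
  rewrite !ffunE big_cons ai mem_facet addrA; congr (_ + _ + _).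
  by case: (q 0 i) => -[|[|?]] //= ?; apply/val_inj.
rewrite step; congr (psi0 _); apply/ffunP => q.
by rewrite !ffunE add0r big_enum_cond.
Qed.

Lemma logical_zero_support s : psi0 s != 0 -> s = affine (s 0) [ffun=> false].
Proof.
have [psiC _ Zpsi] := psi0P.
move=> s0; rewrite [LHS](code_affine psiC s0); congr affine; apply/ffunP => i.
rewrite !ffunE; have := gate_pauliZ (gen [set i]) psi0 s.
rewrite -[gate _ _ _]/(logicalZ i psi0) Zpsi -[LHS]mul1r => /(mulIf s0) /esym.
(* The subgroup is the edge from 0 to [e_ i], so [logicalZ i] forces increment 0 along it. *)
rewrite -[[set i]]setU0 big_gen_setU1 ?inE // gen_set0 big_set1 add0r /= -bit_signD.
by move/bit_sign_eq1; rewrite addF2_neq eq_sym; case: (_ == _).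
Qed.

(** All nonzero amplitudes of [psi0] equal this one, so its vanishing would contradict the unit
    norm. *)
Lemma logical_zero_neq0 : psi0 (affine 0 [ffun=> false]) != 0.
Proof.
have [psiC psi1 _] := psi0P; apply/eqP => p0.
have /eqP := psi1; rewrite big1 ?(eq_sym 0) ?oner_eq0 // => s _.
have [->|/logical_zero_support ->] := eqVneq (psi0 s) 0; first by rewrite normr0 expr0n.
by rewrite code_affine_const // p0 normr0 expr0n.
Qed.

Lemma basis_support a s : logical_basis psi0 a s != 0 -> s = affine (s 0) a.
Proof.
rewrite logical_basisE => /logical_zero_support /ffunP E.
apply/ffunP => q; have := E q; rewrite !ffunE.
rewrite [\sum_(i | [ffun=> false] i) _]big_pred0 => [|i]; last by rewrite ffunE.
rewrite [\sum_(i | a i) (0 : cube m) 0 i]big1 => [|i _]; last by rewrite mxE.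
rewrite !add0r !addr0 => <-.
by rewrite -addrA addrr_F2 addr0.
Qed.

Lemma basis_affine c a :
  logical_basis psi0 a (affine c a) = psi0 (affine 0 [ffun=> false]).
Proof.
have [psiC _ _] := psi0P.
rewrite logical_basisE -[RHS](code_affine_const c _ psiC); congr (psi0 _).
apply/ffunP => q; rewrite !ffunE add0r -addrA addrr_F2.
by rewrite big_pred0 // => i; rewrite ffunE.
Qed.

(** This allows the gate of the empty set, prescribed on code states, to be evaluated on the
    basis. *)
Lemma basis_code a : in_code (logical_basis psi0 a).
Proof.
have [psiC _ _] := psi0P.
split=> [|x J]; first apply/ffunP => s.
  rewrite gate_pauliX !logical_basisE -[RHS](code_flip _ psiC); congr (psi0 _).
  by apply/ffunP => q; rewrite !ffunE inE addrAC.
move=> /eqP/cards2P[i [j [ij ->]]]; apply/ffunP => s; rewrite gate_pauliZ.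
have [->|/basis_support ->] := eqVneq (logical_basis psi0 a s) 0; first by rewrite mulr0.
rewrite big_subcube2 //= -!bit_signD !affine_shift.
suff face (u v w : 'F_2) : u + (u + v) + (u + w + (u + v + w)) = 0.
  by rewrite face mul1r.
rewrite addrACA [u + (u + w)]addrA [u + v + (u + v + w)]addrA.
by rewrite !addrr_F2.
Qed.

(** The basis states have disjoint supports, and on each of them both [psi] and the basis state are
    constant; the coefficient is the ratio of the two amplitudes. *)
Lemma basis_span psi : in_code psi ->
  psi = \sum_a (psi (affine 0 a) / psi0 (affine 0 [ffun=> false])) *:
          logical_basis psi0 a.
Proof.
move=> psiC; apply/ffunP => s; rewrite sum_ffunE.
have term a : logical_basis psi0 a s != 0 -> psi (affine 0 a) = psi s.
  by move/basis_support->; rewrite (code_affine_const (s 0)).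
have [ps|ps] := eqVneq (psi s) 0.
  rewrite ps big1 // => a _; rewrite ffunE.
  have [->|/term ->] := eqVneq (logical_basis psi0 a s) 0; first by rewrite scaler0.
  by rewrite ps mul0r scale0r.
have sE := code_affine psiC ps; set b := [ffun i => _] in sE.
rewrite (bigD1 b) //= big1 ?addr0 => [|a ab].
  rewrite ffunE sE basis_affine (code_affine_const (s 0)) //.
  by rewrite -[_ *: _]/(_ * _) divfK ?logical_zero_neq0.
rewrite ffunE; have [->|/basis_support sa] := eqVneq (logical_basis psi0 a s) 0.
  by rewrite scaler0.
by rewrite sE in sa; rewrite (affine_inj sa) eqxx in ab.
Qed.

(** * Eigenvalues of the phase gate on the logical basis *)

Definition support_sign K a : R[i] := if [exists i in K, a i] then -1 else 1.

Lemma cisX (t : R) n : cis t ^+ n = cis (n%:R * t).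
Proof.
elim: n => [|n IHn]; first by rewrite expr0 mul0r /cis cos0 sin0.
rewrite exprS IHn -natr1 mulrDl mul1r /cis addrC cosD sinD.
by congr Complex; rewrite [sin t * _]mulrC addrC [cos _ * sin t]mulrC.
Qed.

Lemma cis_piS n : cis (pi / (2 : R) ^ (n.+1%:Z - 1)) ^+ (2 ^ n) = -1.
Proof.
have -> : n.+1%:Z - 1 = n%:Z by rewrite -addn1 PoszD addrK.
rewrite cisX natrX -exprnP mulrCA mulfV ?expf_neq0 ?pnatr_eq0 //.
by rewrite mulr1 /cis cospi sinpi; congr Complex; rewrite oppr0.
Qed.

Lemma cis_pi n : cis (pi / (2 : R) ^ (n%:Z - 1)) ^+ (2 ^ n) = 1.
Proof.
case: n => [|n]; last by rewrite expnSr exprM cis_piS sqrrN expr1n.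
(* Here the exponent is -1, so the angle is 2 pi. *)
by rewrite sub0r exprN1 invrK expn0 expr1 mulr_natr /cis cos2pi sin2pi.
Qed.

Lemma Zk_affine K c a :
  \prod_(q in gen K) (if affine c a q == 0 then 1 else
     cis (pi / (2 : R) ^ (#|K|%:Z - 1))) = support_sign K a.
Proof.
set z := cis _; rewrite /support_sign; case: ifPn => [/exists_inP[i iK ai]|].
  rewrite -(setD1K iK) big_gen_setU1 ?setD11 //=.
  (* Exactly one of [q] and [q + e_ i] carries the bit 1, so each pair contributes one [z]. *)
  transitivity (\prod_(q in gen (K :\ i)) z).
    apply: eq_bigr => q _; rewrite affine_shift ai.
    by case: (affine c a q) => -[|[|?]] //= ?; rewrite ?mulr1 ?mul1r.
  rewrite prodr_const card_gen /z -(setD1K iK) cardsU1 setD11 setU1K ?setD11 //.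
  exact: cis_piS.
move=> /exists_inPn aK.
(* Each point of [gen K] has its nonzero coordinates in [K], where [a] vanishes; only the constant
   survives. *)
transitivity (\prod_(q in gen K) (if c == 0 then 1 else z)).
  apply: eq_bigr => q; rewrite in_gen => /forallP qK.
  rewrite ffunE big1 ?addr0 // => i ai.
  have /implyP := qK i; have := aK i.
  case: (q 0 i) => -[|[|?]] // ? aKi; first by move=> _; apply/val_inj.
  by move=> /(_ isT) /aKi; rewrite ai.
rewrite prodr_const card_gen; case: ifP => _; first by rewrite expr1n.
exact: cis_pi.
Qed.

Lemma gate_Zk_basis K a :
  gate (Zk R (#|K|%:Z - 1)) (gen K) (logical_basis psi0 a) =
    support_sign K a *: logical_basis psi0 a.
Proof.
apply/ffunP => s; rewrite gate_diag [RHS]ffunE.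
have [->|/basis_support ->] := eqVneq (logical_basis psi0 a s) 0.
  by rewrite mulr0 scaler0.
congr (_ * _); rewrite -(Zk_affine K (s 0) a); apply: eq_bigr => q _.
by rewrite mxE.
Qed.

Lemma gate_linear_comb (U : 'M[R[i]]_2) A (I : finType) (c : I -> R[i])
    (f : I -> state R m) :
  gate U A (\sum_k c k *: f k) = \sum_k c k *: gate U A (f k).
Proof.
apply/ffunP => s; rewrite !ffunE sum_ffunE.
under eq_bigr do rewrite sum_ffunE mulr_sumr.
rewrite exchange_big; apply: eq_bigr => k _; rewrite !ffunE scaler_sumr.
by apply: eq_bigr => t _; rewrite ffunE /= mulrCA.
Qed.

(** * Eigenvalues of the controlled gates *)

Variable (CZ : {set 'I_m} -> {linear state R m -> state R m}).
Hypothesis CZP : forall J, is_multi_CZ psi0 J (CZ J).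

(** The empty set is excluded because the control condition holds vacuously there while the gate is
    the identity. *)
Definition multi_CZ_sign J a : R[i] :=
  if (J != set0) && (J \subset [set i | a i]) then -1 else 1.

Lemma CZ_basis J a :
  CZ J (logical_basis psi0 a) = multi_CZ_sign J a *: logical_basis psi0 a.
Proof.
have := CZP J; rewrite /is_multi_CZ /multi_CZ_sign; case: eqP => [_ -> | _ ->].
- by rewrite scale1r.
- exact: basis_code.
have -> : (J \subset [set i | a i]) = [forall i in J, a i].
  by apply/subsetP/forall_inP => aJ i /aJ; rewrite inE.
by case: ifP; rewrite ?scaleN1r ?scale1r.
Qed.

Lemma comp_CZ_basis (r : seq {set 'I_m}) (c : {ffun 'I_m -> bool} -> R[i]) :
  comp_all r (fun J => CZ J) (\sum_a c a *: logical_basis psi0 a) =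
    \sum_a c a *: ((\prod_(J <- r) multi_CZ_sign J a) *: logical_basis psi0 a).
Proof.
elim: r => [|J r IHr] /=.
  by apply: eq_bigr => a _; rewrite big_nil scale1r.
rewrite IHr linear_sum; apply: eq_bigr => a _.
rewrite !linearZ /= CZ_basis big_cons !scalerA.
by rewrite [in RHS]mulrC [multi_CZ_sign J a * _]mulrC mulrA.
Qed.

Lemma prod_multi_CZ_sign K a :
  \prod_(J <- enum (powerset K)) multi_CZ_sign J a = support_sign K a.
Proof.
rewrite big_enum /= /support_sign.
have -> : [exists i in K, a i] = ([set i in K | a i] != set0).
  apply/exists_inP/set0Pn => -[j]; first by move=> jK aj; exists j; rewrite inE jK.
  by rewrite inE => /andP[]; exists j.
set A := [set _ in _ | _].
transitivity (\prod_(J in powerset A :\ set0) (-1 : R[i])).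
  rewrite [RHS]big_mkcond [LHS]big_mkcond; apply: eq_bigr => J _.
  rewrite !inE /multi_CZ_sign.
  have -> : (J \subset A) = (J \subset K) && (J \subset [set i | a i]).
    rewrite -subsetI; suff -> : A = K :&: [set i | a i] by [].
    by apply/setP => i; rewrite !inE.
  by case: (J == set0); case: (J \subset K); case: (J \subset _).
rewrite prodr_const.
(* The number of factors -1 is one less than 2^|A|, hence odd exactly when [A] is nonempty. *)
have := cardsD1 set0 (powerset A); rewrite card_powerset inE sub0set add1n.
move=> cA; rewrite -signr_odd; have := congr1 odd cA.
rewrite oddX orbF cards_eq0 /=; case: (A == set0) => /esym.
  by move/negbTE->.
by move/negbFE->.
Qed.

End Basis.

Theorem lemma8p4 (R : realType) (m : nat) (hm : (1 <= m)%N)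
  (psi0 : state R m) (hpsi0 : logical_zero psi0)
  (CZ : {set 'I_m} -> {linear state R m -> state R m})
  (hCZ : forall J : {set 'I_m}, is_multi_CZ psi0 J (CZ J))
  (K : {set 'I_m}) :
  code_equiv (gate (Zk R (#|K|%:Z - 1)) (gen K))
             (comp_all (enum (powerset K)) (fun J => CZ J)).
Proof.
(* The eigenvalues agree exactly on the logical basis, so the global phase is trivial. *)
exists 0 => psi psiC; rewrite /cis cos0 sin0 scale1r (basis_span hpsi0 psiC).
rewrite gate_linear_comb comp_CZ_basis //; apply: eq_bigr => a _.
by rewrite gate_Zk_basis // prod_multi_CZ_sign.
Qed.
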